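(* Let $\mathbb{F}$ be a field. A simplicial complex $X$ of dimension $d$ is $\mathbb{F}$-tight if and only if $X$ is $2$-neighbourly and $\mu_i(X;\mathbb{F})=\beta_i(X;\mathbb{F})$ for all indices $i$ with $0\le i\le d$.
   Context: All simplicial complexes are finite and abstract, and the empty set is a face of each. $V(X)$ is the vertex set of $X$; for a set $A$, $X[A]=\{\alpha\in X:\alpha\subseteq A\}$ is the induced subcomplex of $X$ on $A\cap V(X)$. $X$ is $2$-neighbourly if any two vertices of $X$ form a face of $X$. The link of a vertex $x$ is $\mathrm{lk}_X(x)=\{\alpha\in X: x\notin\alpha,\ \alpha\cup\{x\}\in X\}$. A $d$-dimensional simplicial complex $X$ is $\mathbb F$-tight if $X$ is connected and, for all induced subcomplexes $Y$ of $X$ and all $0\le j\le d$, the morphism $H_j(Y;\mathbb F)\to H_j(X;\mathbb F)$ induced by the inclusion $Y\hookrightarrow X$ is injective. Homology is simplicial with coefficients in $\mathbb{F}$; $\beta_i(X)=\dim_{\mathbb F}H_i(X;\mathbb F)$. Reduced Betti numbers: $\widetilde\beta_i=\beta_i$ for $i\ne0$, $\widetilde\beta_0=\beta_0-1$; in particular, for the complex $\emptyset$ whose only face is the empty set, $\widetilde\beta_0(\emptyset)=-1$ and $\widetilde\beta_i(\emptyset)=0$ for $i\neq 0$. For a complex $X$ with $m$ vertices, the sigma-vector has components $$\sigma_i(X)=\sum_{j=0}^{m}\frac{1}{\binom mj}\sum_{A\subseteq V(X),\ \#(A)=j}\widetilde\beta_i(X[A])$$ (this formula being used for every $i\ge 0$).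 If $\dim X=d$, the mu-vector $(\mu_0,\dots,\mu_d)$ of $X$ is given by $\mu_0(X)=1$ and $$\mu_i(X)=\delta_{i1}+\frac1m\sum_{x\in V(X)}\sigma_{i-1}(\mathrm{lk}_X(x)),\quad 1\le i\le d,$$ where $\delta$ is the Kronecker delta. *)

(* Defs.v *)
From HB Require Import structures.
From mathcomp Require Import all_boot all_order all_algebra.

Set Implicit Arguments.
Unset Strict Implicit.
Unset Printing Implicit Defensive.

Import Order.TTheory GRing.Theory Num.Theory.
Local Open Scope ring_scope.

(* The ambient type T may be larger than the vertex set: V(X) consists of those
   v : T with [set v] \in X. *)
Section Complexes.

Variable T : finType.
Implicit Types (X Y : {set {set T}}) (A a b : {set T}) (x v : T).

Definition is_complex X : bool :=
  (set0 \in X) && [forall a in X, forall b : {set T}, (b \subset a) ==> (b \in X)].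

Definition vertices X : {set T} := [set v | [set v] \in X].

(* The complex [set set0] has dimension -1. *)
Definition dimc X : int := (\max_(a in X) #|a|)%N%:Z - 1.

Definition induced X A : {set {set T}} := [set a in X | a \subset A].

Definition link X x : {set {set T}} :=
  [set a in X | (x \notin a) && (x |: a \in X)].

Definition two_neighbourly X : Prop :=
  forall u v, u \in vertices X -> v \in vertices X -> [set u; v] \in X.

Definition connected X : Prop :=
  forall u v, u \in vertices X -> v \in vertices X ->
    connect [rel x y | [set x; y] \in X] u v.

End Complexes.

(* The quotient space U / W is realized on the library's complement
   U :\: W of U :&: W in U; the class of z \in U is its projection to U :\: W
   along W.  Lemmas quot_classP and quot_class_repr say that quot_class is onto
   and that two vectors of U have the same class iff they differ by an element
   of W. *)
Section Quotient.

Variables (F : fieldType) (V : vectType F).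
Implicit Types U W : {vspace V}.

Definition quot U W : vectType F := subvs_of (U :\: W).

Definition quot_class U W (z : V) : quot U W :=
  vsproj (U :\: W) (addv_pi1 U W z).

Definition quot_repr U W (h : quot U W) : V := vsval h.

Lemma addv_pi1_diff U W z : addv_pi1 U W z \in (U :\: W)%VS.
Proof. by rewrite /addv_pi1 memv_pi. Qed.

Lemma val_quot_class U W z : quot_repr (quot_class U W z) = addv_pi1 U W z.
Proof. exact/vsprojK/addv_pi1_diff. Qed.

Lemma quot_repr_mem U W (h : quot U W) : quot_repr h \in U.
Proof. by apply: (subvP (diffvSl U W)); apply: subvsP. Qed.

Lemma addv_pi1_eq0 U W z :
  z \in (U + W)%VS -> (addv_pi1 U W z == 0) = (z \in W).
Proof.
move=> UWz; apply/idP/idP=> [/eqP z0 | Wz].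
  by rewrite -(addv_pi1_pi2 UWz) z0 add0r memv_pi2.
rewrite -memv0 -(capv_diff U W) memv_cap addv_pi1_diff /=.
have /(canRL (addrK _)) -> := addv_pi1_pi2 UWz.
by rewrite rpredB ?memv_pi2.
Qed.

Lemma quot_classP U W z z' : z \in U -> z' \in U ->
  quot_class U W z = quot_class U W z' <-> z - z' \in W.
Proof.
move=> Uz Uz'; rewrite -(@addv_pi1_eq0 U) ?(subvP (addvSl U W)) ?rpredB //.
rewrite linearB subr_eq0; split=> [eq_zz' | /eqP eq_zz'].
  by rewrite -[X in X == _]val_quot_class eq_zz' val_quot_class.
by apply: subvs_inj; rewrite -!/(quot_repr _) !val_quot_class.
Qed.

Lemma quot_class_repr U W (h : quot U W) : quot_class U W (quot_repr h) = h.
Proof.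
apply: subvs_inj; rewrite -!/(quot_repr _) val_quot_class.
by rewrite /addv_pi1 daddv_pi_id ?capv_diff //; apply: subvsP.
Qed.

Lemma quot_class_is_linear U W : linear (quot_class U W).
Proof. by move=> k u v; rewrite /quot_class !linearP. Qed.

HB.instance Definition _ U W :=
  GRing.isLinear.Build F V (quot U W) *:%R (quot_class U W)
    (quot_class_is_linear U W).

End Quotient.

(* All chains live in one ambient space, indexed by all subsets of T, so that
   for Y \subset X the inclusion of chain groups is the identity on vectors. *)
Section Homology.

Variables (F : fieldType) (T : finType).
Implicit Types (X Y : {set {set T}}) (a : {set T}) (v : T) (j : nat).

Definition chain : vectType F := {ffun {set T} -> F^o}.

Definition face_chain a : chain := [ffun b => (b == a)%:R].

(* Position of v among the vertices of a, for the enumeration order of T. *)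
Definition position v a : nat :=
  #|[set w in a | (enum_rank w < enum_rank v)%N]|.

(* The boundary of a vertex is 0 (unreduced homology). *)
Definition face_boundary a : chain :=
  if (1 < #|a|)%N
  then \sum_(v in a) (-1) ^+ position v a *: face_chain (a :\ v)
  else 0.

Definition boundary_fun (c : chain) : chain := \sum_a c a *: face_boundary a.

Lemma boundary_fun_is_linear : linear boundary_fun.
Proof.
move=> k c c'; rewrite /boundary_fun scaler_sumr -big_split /=.
by apply: eq_bigr => a _; rewrite !ffunE scalerDl scalerA.
Qed.

HB.instance Definition _ :=
  GRing.isLinear.Build F chain chain *:%R boundary_fun boundary_fun_is_linear.

Definition boundary : 'End(chain) := linfun boundary_fun.

Definition chains X j : {vspace chain} :=
  <<[seq face_chain a | a in [pred a in X | #|a| == j.+1]]>>%VS.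

Definition cycles X j : {vspace chain} := (chains X j :&: lker boundary)%VS.

Definition boundaries X j : {vspace chain} := (boundary @: chains X j.+1)%VS.

Definition homology X j : vectType F := quot (cycles X j) (boundaries X j).

Definition homology_class X j (z : chain) : homology X j :=
  quot_class (cycles X j) (boundaries X j) z.

Definition betti X j : nat := \dim {: homology X j}.

(* The morphism induced by an inclusion Y \subset X; by homology_map_class it
   sends the class of a cycle z of Y to the class of z in X. *)
Definition homology_map Y X j (h : homology Y j) : homology X j :=
  homology_class X j (quot_repr h).

Lemma chainsS Y X j : Y \subset X -> (chains Y j <= chains X j)%VS.
Proof.
move=> sYX; apply: sub_span => _ /imageP[a /andP[Ya ja] ->].
by apply/imageP; exists a => //; apply/andP; split; rewrite ?(subsetP sYX).
Qed.

Lemma homology_map_class Y X j z : Y \subset X -> z \in cycles Y j ->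
  homology_map X (homology_class Y j z) = homology_class X j z.
Proof.
move=> sYX Zz; have sZ: (cycles Y j <= cycles X j)%VS by rewrite capvS ?chainsS.
apply/quot_classP; try exact: (subvP sZ) (quot_repr_mem _).
  exact: (subvP sZ).
apply: (subvP (limgS _ (chainsS j.+1 sYX))); rewrite -/(boundaries Y j).
by apply: (proj1 (quot_classP _ (quot_repr_mem _) Zz)); apply: quot_class_repr.
Qed.

Lemma homology_map_is_linear Y X j : linear (@homology_map Y X j).
Proof.
by move=> k u v; rewrite /homology_map /quot_repr /homology_class !linearP.
Qed.

HB.instance Definition _ Y X j :=
  GRing.isLinear.Build F (homology Y j) (homology X j) *:%R
    (@homology_map Y X j) (@homology_map_is_linear Y X j).

Definition tight X : Prop :=
  connected X /\
  forall (A : {set T}) j, j%:Z <= dimc X ->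
    injective (@homology_map (induced X A) X j).

(* An integer: it is -1 for i = 0 and X = [set set0]. *)
Definition reduced_betti X (i : nat) : int := (betti X i)%:Z - (i == 0)%N%:Z.

Definition sigma X (i : nat) : rat :=
  let m := #|vertices X| in
  \sum_(0 <= j < m.+1)
    ('C(m, j)%:R)^-1 *
    \sum_(A : {set T} | (A \subset vertices X) && (#|A| == j))
      (reduced_betti (induced X A) i)%:~R.

Definition mu X (i : nat) : rat :=
  if i is k.+1 then
    (i == 1)%N%:R +
    (#|vertices X|%:R)^-1 * \sum_(x in vertices X) sigma (link X x) k
  else 1.

End Homology.

Arguments tight F {T} X.
Arguments sigma F {T} X i.
Arguments mu F {T} X i.
Arguments betti F {T} X j.
Arguments reduced_betti F {T} X i.

(* Main.v *)
From HB Require Import structures.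
Require Import Defs.
From mathcomp Require Import all_boot all_order all_algebra.
From mathcomp Require Import zify ring lra.

(** Add the vertices of X one at a time.  Passing from Y = X[A] to
    Z = X[A + x] glues to Y a cone over L = lk(x)[A], and the long exact
    sequence of the pair (Z, Y), whose i-th relative homology is the reduced
    homology of L in degree i - 1, gives
      beta_i(Z) - beta_i(Y) = rho_i - k_(i+1) - k_i,
    where rho_i is the reduced Betti number of L in degree i - 1 and k_(j+1) is
    the dimension of the kernel of H_j(Y) -> H_j(Z) (k_0 = 0).  No relative
    homology is needed: everything is a count of ranks of boundary maps
    (betti_step), the kernel dimension being the number defect of independent
    cycles of Y that bound in Z but not in Y.

    Sum this identity over all orderings of the vertex set V and average.  A
    given vertex x is preceded exactly by the vertices in A with probability
    w(A) = 1 / (m C(m - 1, #A)), m = #V.  The orderings themselves can be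
    avoided: for every function f of subsets,
      sum over x in V, A in V - x of w(A) (f(A + x) - f(A)) = f(V) - f(0)
    (weighted_sum_differences).  When X is 2-neighbourly, the link of x has all
    other vertices as its vertices, so that the average of rho_i is mu_i
    (mu_weighted_sum); the Kronecker delta and mu_0 = 1 correct for the
    convention that the complex with the only face the empty set has reduced
    Betti number -1 in degree 0, instead of 1 in degree -1.  Hence
    (mu_sub_betti)
      mu_i - beta_i = sum of w(A) (k_(i+1)(A, x) + k_i(A, x)) >= 0.

    All weights are positive, so mu_i = beta_i for all i <= d iff all the maps
    H_j(X[A]) -> H_j(X[A + x]) with j <= d are injective.  By composition this
    amounts to injectivity of all H_j(X[A]) -> H_j(X), that is, to tightness
    (injective_all_iff_steps).  Tightness in turn forces X to be 2-neighbourly: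
    if u and v were not joined by an edge, the class of u - v would be nonzero
    in H_0 of X[u, v], and zero in H_0 of the connected X
    (tight_two_neighbourly). *)

Set Implicit Arguments.
Unset Strict Implicit.
Unset Printing Implicit Defensive.

Import Order.TTheory GRing.Theory Num.Theory.
Local Open Scope ring_scope.

(** * Averaging over vertex orderings without orderings *)

Section WeightedSum.
Variable T : finType.
Implicit Types (V A B : {set T}) (x : T).

(** The probability that, in a uniformly random ordering of V, a fixed x in
    V - A comes right after all the elements of A and before the others. *)
Definition weight V A : rat := (#|V|%:R * 'C(#|V|.-1, #|A|)%:R)^-1.

Lemma weight_up V A : A \subset V -> A != V ->
  (#|V| - #|A|)%:R * weight V A = 'C(#|V|, #|A|)%:R^-1.
Proof.
move=> sAV neAV; have ltAV: (#|A| < #|V|)%N by rewrite proper_card // properEneq neAV.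
have E := mul_bin_down #|V| #|A|.
have C0 : ('C(#|V|, #|A|)%:R != 0 :> rat) by rewrite pnatr_eq0 -lt0n bin_gt0 subset_leq_card.
have D0 : ((#|V| - #|A|)%:R != 0 :> rat) by rewrite pnatr_eq0 -lt0n subn_gt0.
by rewrite /weight -natrM E natrM invfM mulrA divff // mul1r.
Qed.

Lemma weight_down V B : B \subset V -> B != set0 ->
  #|B|%:R * (#|V|%:R * 'C(#|V|.-1, #|B|.-1)%:R)^-1 = 'C(#|V|, #|B|)%:R^-1 :> rat.
Proof.
rewrite -card_gt0 => sBV B0; have := subset_leq_card sBV.
have E := mul_bin_diag #|V| #|B|.-1; rewrite prednK // in E => leBV.
have D0 : (#|B|%:R != 0 :> rat) by rewrite pnatr_eq0 -lt0n.
by rewrite -natrM E natrM invfM mulrA divff // mul1r.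
Qed.

(** Along one ordering of V the differences of f telescope, and the weights
    are the average over all orderings.  Directly: after exchanging the sums,
    a set B of size k collects k w(k - 1) from the first term and
    (m - k) w(k) from the second; both are 1 / C(m, k), except that the first
    is absent for B = 0 and the second for B = V. *)
Lemma weighted_sum_differences V (f : {set T} -> rat) :
  \sum_(x in V) \sum_(A : {set T} | A \subset V :\ x)
     weight V A * (f (x |: A) - f A) = f V - f set0.
Proof.
under eq_bigr => x _ do under eq_bigr => A _ do rewrite mulrBr.
under eq_bigr => x _ do rewrite sumrB.
rewrite sumrB.
have ->: \sum_(x in V) \sum_(A : {set T} | A \subset V :\ x) weight V A * f (x |: A)
   = \sum_(B : {set T} | (B \subset V) && (B != set0)) 'C(#|V|, #|B|)%:R^-1 * f B.
  transitivity (\sum_(x in V) \sum_(B : {set T} | (B \subset V) && (x \in B))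
      (#|V|%:R * 'C(#|V|.-1, #|B|.-1)%:R)^-1 * f B).
    apply: eq_bigr => x Vx.
    rewrite (reindex_onto (fun B => B :\ x) (fun A => x |: A)) /=; last first.
      by move=> A; rewrite subsetD1 => /andP[_ nAx]; rewrite setU1K.
    apply: eq_big => [B|B].
      apply/andP/andP=> [[sB /eqP EB]|[sB xB]].
        by split; [rewrite -EB subUset sub1set Vx (subset_trans sB) ?subsetDl|
                   rewrite -EB setU11].
      by rewrite setD1K // eqxx setSD.
    case/andP=> _ /eqP EB; rewrite EB; congr (_ * _).
    by rewrite /weight (cardsD1 x B) -EB setU11.
  rewrite (exchange_big_dep (fun B : {set T} => (B \subset V) && (B != set0))) /=; last first.
    by move=> x B Vx /andP[-> xB]; apply/set0Pn; exists x.
  apply: eq_bigr => B /andP[sB B0]; rewrite -(weight_down sB B0) -[RHS]mulrA [RHS]mulr_natl.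
  rewrite -[RHS]sumr_const; apply: eq_bigl => x; rewrite sB /=.
  by apply/andb_idl/(subsetP sB).
have ->: \sum_(x in V) \sum_(A : {set T} | A \subset V :\ x) weight V A * f A
   = \sum_(A : {set T} | (A \subset V) && (A != V)) 'C(#|V|, #|A|)%:R^-1 * f A.
  rewrite (exchange_big_dep (fun A : {set T} => (A \subset V) && (A != V))) /=; last first.
    move=> x A Vx; rewrite subsetD1 => /andP[-> nAx].
    by apply: contra nAx => /eqP->.
  apply: eq_bigr => A /andP[sA neA]; rewrite -(weight_up sA neA) -[RHS]mulrA [RHS]mulr_natl.
  rewrite -(cardsDS sA) -[RHS]sumr_const; apply: eq_bigl => x.
  by rewrite inE subsetD1 sA /= andbC.
have [V0|V0] := eqVneq V set0.
  by rewrite V0 !subrr.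
rewrite (bigD1 V) /= ?subxx // [X in _ - X](bigD1 set0) /=; last by rewrite sub0set eq_sym.
rewrite binn cards0 bin0 invr1 !mul1r opprD addrACA [X in _ + X](_ : _ = 0) ?addr0 //.
apply/eqP; rewrite subr_eq0; apply/eqP; apply: eq_bigl => A.
by rewrite andbAC.
Qed.

Lemma weight_gt0 V A x : A \subset V :\ x -> x \in V -> 0 < weight V A.
Proof.
move=> sA Vx; have := subset_leq_card sA; have := cardsD1 x V; rewrite Vx /= => E le.
rewrite invr_gt0 -natrM ltr0n muln_gt0 bin_gt0 E /=.
exact: le.
Qed.

Lemma weight0_sum V : V != set0 -> \sum_(x in V) weight V set0 = 1.
Proof.
move=> V0; rewrite sumr_const /weight cards0 bin0 mulr1 -[LHS]mulr_natl divff //.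
by rewrite pnatr_eq0 cards_eq0.
Qed.
End WeightedSum.

(** * Chains and augmented boundaries *)

Lemma complexP (T : finType) (X : {set {set T}}) : is_complex X ->
  set0 \in X /\ forall a b : {set T}, a \in X -> b \subset a -> b \in X.
Proof.
case/andP=> X0 /forall_inP H; split=> // a b Xa sba.
by have /forallP/(_ b)/implyP := H a Xa; apply.
Qed.

Section Chains.
Variables (F : fieldType) (T : finType).
Implicit Types (X Y : {set {set T}}) (A B a b : {set T}).
Implicit Types (x v w : T) (s : nat) (c : chain F T).

Local Notation face := (face_chain F).
Local Notation bd := (boundary F T).

(** The space chains X j is sized_chains X j.+1.  Indexing by size keeps the
    degree -1 of the augmented chain complex, which the links need. *)
Definition sized_chains X s : {vspace chain F T} :=
  <<[seq face a | a in [pred a in X | #|a| == s]]>>%VS.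

Lemma chain_expand c : c = \sum_a c a *: face a.
Proof.
apply/ffunP => b; rewrite sum_ffunE (bigD1 b) //= !ffunE eqxx /GRing.scale /= mulr1.
rewrite big1 ?addr0 // => a; rewrite !ffunE /GRing.scale /= eq_sym => /negPf->.
by rewrite mulr0.
Qed.

Lemma face_sized_chains X s a : a \in X -> #|a| = s -> face a \in sized_chains X s.
Proof. by move=> Xa /eqP sa; apply/memv_span/image_f; apply/andP. Qed.

Lemma sized_chainsP X s c :
  reflect (forall a, c a != 0 -> a \in X /\ #|a| = s) (c \in sized_chains X s).
Proof.
apply: (iffP idP) => [|Hc]; last first.
  rewrite [c]chain_expand memv_suml // => a _.
  have [-> | /Hc[Xa sa]] := eqVneq (c a) 0; first by rewrite scale0r mem0v.
  by rewrite memvZ ?face_sized_chains.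
rewrite /sized_chains; set r := image_mem _ _.
rewrite -[r]/(tval (in_tuple r)) => /coord_span-> a; rewrite sum_ffunE => nz.
have [//|H] := boolP ((a \in X) && (#|a| == s)); first by case/andP=> ? /eqP.
case/eqP: nz; rewrite big1 // => i _; rewrite ffunE.
have /imageP[b Hb ->]: (in_tuple r)`_i \in r by rewrite mem_nth.
rewrite ffunE; case: eqP => [eab|_]; last exact: mulr0.
by move: H; rewrite eab [_ && _]Hb.
Qed.

Lemma sized_chains_imgP X s (f : 'End(chain F T)) (U : {vspace chain F T}) :
  (forall a, a \in X -> #|a| = s -> f (face a) \in U) -> (f @: sized_chains X s <= U)%VS.
Proof.
move=> H; rewrite limg_span; apply/span_subvP => _ /mapP[_ /imageP[a /andP[Xa /eqP sa] ->] ->].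
exact: H.
Qed.

(** In contrast with face_boundary, the boundary of a vertex is here the empty
    face. *)
Definition aug_face_boundary a : chain F T :=
  \sum_(v in a) (-1) ^+ position v a *: face (a :\ v).

Definition aug_boundary_fun c : chain F T := \sum_a c a *: aug_face_boundary a.

Lemma aug_boundary_fun_is_linear : linear aug_boundary_fun.
Proof.
move=> k c c'; rewrite /aug_boundary_fun scaler_sumr -big_split /=.
by apply: eq_bigr => a _; rewrite !ffunE scalerDl scalerA.
Qed.

HB.instance Definition _ :=
  GRing.isLinear.Build F (chain F T) (chain F T) *:%R aug_boundary_fun aug_boundary_fun_is_linear.

Definition aug_boundary : 'End(chain F T) := linfun aug_boundary_fun.

Lemma sum_face (g : {set T} -> chain F T) a : \sum_b face a b *: g b = g a.
Proof.
rewrite (bigD1 a) //= ffunE eqxx scale1r big1 ?addr0 // => b /negPf ba.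
by rewrite ffunE ba scale0r.
Qed.

Lemma boundary_face a : bd (face a) = face_boundary F a.
Proof. by rewrite lfunE /= /boundary_fun sum_face. Qed.

Lemma aug_boundary_face a : aug_boundary (face a) = aug_face_boundary a.
Proof. by rewrite lfunE /= /aug_boundary_fun sum_face. Qed.

Lemma eq_on_faces X s (f g : 'End(chain F T)) c :
  (forall a, a \in X -> #|a| = s -> f (face a) = g (face a)) ->
  c \in sized_chains X s -> f c = g c.
Proof.
move=> H /sized_chainsP Hc; rewrite [c]chain_expand !linear_sum.
apply: eq_bigr => a _; rewrite !linearZ /=.
have [-> | /Hc[Xa sa]] := eqVneq (c a) 0; first by rewrite !scale0r.
by rewrite H.
Qed.

Lemma eq_aug_boundary X s c : (1 < s)%N -> c \in sized_chains X s ->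
  bd c = aug_boundary c.
Proof.
move=> s1; apply: eq_on_faces => a _ sa.
by rewrite boundary_face aug_boundary_face /face_boundary sa s1.
Qed.

Lemma limg_boundary1 X : (bd @: sized_chains X 1 = 0)%VS.
Proof.
apply/eqP; rewrite -subv0; apply: sized_chains_imgP => a _ sa.
by rewrite boundary_face /face_boundary sa ltnn mem0v.
Qed.

Lemma limg_boundary0 X : (bd @: sized_chains X 0 = 0)%VS.
Proof.
apply/eqP; rewrite -subv0; apply: sized_chains_imgP => a _ sa.
by rewrite boundary_face /face_boundary sa mem0v.
Qed.

Lemma limg_aug_boundary X s : (1 < s)%N ->
  (bd @: sized_chains X s = aug_boundary @: sized_chains X s)%VS.
Proof. by move=> s1; apply: eq_in_limg => c; apply: eq_aug_boundary. Qed.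

Lemma limg_aug_boundary0 X : (aug_boundary @: sized_chains X 0 = 0)%VS.
Proof.
apply/eqP; rewrite -subv0; apply: sized_chains_imgP => a _ /eqP.
rewrite cards_eq0 => /eqP->; rewrite aug_boundary_face /aug_face_boundary.
by rewrite big_set0 mem0v.
Qed.

Lemma position_setD1 v x a :
  position v a = (position v (a :\ x) + ((x \in a) && (enum_rank x < enum_rank v)))%N.
Proof.
rewrite /position (cardsD1 x) inE addnC; congr (_ + _)%N; apply: eq_card => w.
by rewrite !inE andbA.
Qed.

Lemma position_setU1 v x a : x \notin a ->
  position v (x |: a) = (position v a + (enum_rank x < enum_rank v))%N.
Proof. by move=> nax; rewrite (position_setD1 v x) setU1K // setU11. Qed.

Lemma position_set1 v x : position v [set x] = (enum_rank x < enum_rank v)%N.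
Proof.
rewrite (position_setD1 v x) setDv set11 [position v set0](_ : _ = 0%N) //.
by apply: eq_card0 => w; rewrite !inE.
Qed.

(** The faces a - v - w and a - w - v cancel.  The double sum is split
    according to the order of v and w, and the two halves are matched, because
    in characteristic 2 a sum equal to its opposite need not vanish. *)
Lemma aug_boundaryK c : aug_boundary (aug_boundary c) = 0.
Proof.
suff H a : aug_boundary (aug_boundary (face a)) = 0.
  rewrite [c]chain_expand !linear_sum big1 // => a _.
  by rewrite !linearZ /= H scaler0.
rewrite aug_boundary_face linear_sum /=.
pose G v w : chain F T :=
  ((-1) ^+ position v a * (-1) ^+ position w (a :\ v)) *: face (a :\ v :\ w).
rewrite (eq_bigr (fun v => \sum_(w in a | w != v) G v w)); last first.
  move=> v av; rewrite linearZ /= aug_boundary_face scaler_sumr.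
  by apply: eq_big => [w|w _]; rewrite ?scalerA // !inE andbC.
have G_anti v w : v \in a -> w \in a -> (enum_rank v < enum_rank w)%N -> G v w = - G w v.
  move=> av aw ltvw; rewrite /G -scaleNr setDDl setUC -setDDl; congr (_ *: _).
  rewrite (position_setD1 w v a) (position_setD1 v w a) av aw ltvw ltnNge (ltnW ltvw).
  by rewrite addn0 addn1 exprS mulN1r mulNr opprK mulrC.
rewrite (eq_bigr (fun v => \sum_(w in a | (enum_rank v < enum_rank w)%N) G v w +
                           \sum_(w in a | (enum_rank w < enum_rank v)%N) G v w)); last first.
  move=> v av; rewrite (bigID (fun w => enum_rank v < enum_rank w)%N) /=.
  congr (_ + _); apply: eq_bigl => w; case: (w \in a) => //=;
    rewrite -(inj_eq enum_rank_inj) -val_eqE /=; lia.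
rewrite big_split /= [X in _ + X](exchange_big_dep (fun w => w \in a)) /=; last first.
  by move=> ? ? _ /andP[].
rewrite -big_split big1 //= => v av.
rewrite [X in _ + X](eq_bigl (fun w => (w \in a) && (enum_rank v < enum_rank w)%N)); last first.
  by move=> w; rewrite av.
rewrite -big_split big1 //= => w /andP[aw ltvw]; by rewrite G_anti // addNr.
Qed.

Lemma sized_chainsS X Y s : Y \subset X -> (sized_chains Y s <= sized_chains X s)%VS.
Proof.
move=> sYX; apply/subvP => c /sized_chainsP Hc; apply/sized_chainsP => a /Hc[Ya ?].
by split=> //; apply: (subsetP sYX).
Qed.

Lemma aug_boundary_sized X s : is_complex X ->
  (aug_boundary @: sized_chains X s.+1 <= sized_chains X s)%VS.
Proof.
case/complexP=> _ Xsub; apply: sized_chains_imgP => a Xa sa; rewrite aug_boundary_face.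
apply: memv_suml => v av; rewrite memvZ // face_sized_chains //.
  by apply: Xsub Xa (subsetDl _ _).
by apply: succn_inj; rewrite -sa (cardsD1 v a) av.
Qed.

Lemma boundary_sized X s : is_complex X ->
  (bd @: sized_chains X s.+1 <= sized_chains X s)%VS.
Proof.
move=> Xc; case: s => [|s]; first by rewrite limg_boundary1 sub0v.
by rewrite limg_aug_boundary ?aug_boundary_sized.
Qed.

Lemma boundaryK X s c : is_complex X -> c \in sized_chains X s.+1 -> bd (bd c) = 0.
Proof.
move=> Xc cX; have bX : bd c \in sized_chains X s.
  by rewrite (subvP (boundary_sized s Xc)) ?memv_img.
case: s => [|s] in cX bX *.
  by apply/eqP; rewrite -memv0 -(limg_boundary0 X) memv_img.
case: s => [|s] in cX bX *.
  by apply/eqP; rewrite -memv0 -(limg_boundary1 X) memv_img.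
by rewrite (eq_aug_boundary _ bX) // (eq_aug_boundary _ cX) // aug_boundaryK.
Qed.

Lemma betti_rank X j : is_complex X ->
  (betti F X j + \dim (bd @: sized_chains X j.+1) + \dim (bd @: sized_chains X j.+2)
   = \dim (sized_chains X j.+1))%N.
Proof.
move=> Xc; rewrite /betti dimvf -[dim _]/(\dim (cycles F X j :\: boundaries F X j)).
have := dimv_cap_compl (cycles F X j) (boundaries F X j).
have -> : (cycles F X j :&: boundaries F X j = bd @: sized_chains X j.+2)%VS.
  apply/capv_idPr; rewrite subv_cap boundary_sized //=.
  apply/subvP => _ /memv_imgP[c cX ->]; rewrite memv_ker; apply/eqP.
  exact: boundaryK cX.
have := limg_ker_dim bd (sized_chains X j.+1).
rewrite -[(_ :&: lker _)%VS]/(cycles F X j) => <- <-; lia.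
Qed.

(** A class of Y dies in X iff its cycles bound in X; by boundaryK a chain
    that bounds in X is a cycle, so that plain chains of Y may be considered. *)
Lemma homology_map_inj X Y j : is_complex X -> is_complex Y -> Y \subset X ->
  injective (@homology_map F T Y X j) <->
  (sized_chains Y j.+1 :&: (bd @: sized_chains X j.+2) <= bd @: sized_chains Y j.+2)%VS.
Proof.
move=> Xc Yc sYX.
have sZ : (cycles F Y j <= cycles F X j)%VS by rewrite capvS ?chainsS.
split=> [inj | sub h h' /quot_classP].
  apply/subvP => z /memv_capP[zY zX].
  have zc : z \in cycles F Y j.
    rewrite memv_cap zY memv_ker; case/memv_imgP: zX => c cX ->; apply/eqP.
    exact: boundaryK cX.
  have: homology_class Y j z = homology_class Y j 0.
    apply: inj; rewrite !homology_map_class ?mem0v //; apply/quot_classP.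
    - exact: subvP sZ _ zc.
    - exact: mem0v.
    by rewrite subr0.
  by move/quot_classP; rewrite subr0; apply=> //; apply: mem0v.
move=> /(_ (subvP sZ _ (quot_repr_mem h)) (subvP sZ _ (quot_repr_mem h'))) hX.
rewrite -(quot_class_repr h) -(quot_class_repr h'); apply/quot_classP; try exact: quot_repr_mem.
apply: (subvP sub); rewrite memv_cap hX andbT.
have /memv_capP[] : quot_repr h - quot_repr h' \in cycles F Y j by rewrite rpredB ?quot_repr_mem.
by [].
Qed.

End Chains.

(** * Induced subcomplexes and links *)

Section Subcomplexes.
Variable T : finType.
Implicit Types (X : {set {set T}}) (A B a b : {set T}) (x v : T).

Lemma induced_complex X A : is_complex X -> is_complex (induced X A).
Proof.
case/complexP=> X0 Xsub; apply/andP; split; first by rewrite inE X0 sub0set.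
apply/forall_inP => a; rewrite inE => /andP[Xa saA]; apply/forallP => b; apply/implyP => sba.
by rewrite inE (Xsub a) // (subset_trans sba).
Qed.

Lemma inducedS X A B : A \subset B -> induced X A \subset induced X B.
Proof. by move=> sAB; apply/subsetP => a; rewrite !inE => /andP[-> /subset_trans->]. Qed.

Lemma induced_vertices X : is_complex X -> induced X (vertices X) = X.
Proof.
case/complexP=> _ Xsub; apply/setP => a; rewrite inE; apply: andb_idr => Xa.
by apply/subsetP => v av; rewrite inE (Xsub a) // sub1set.
Qed.

Lemma induced_setI X A : is_complex X -> induced X (A :&: vertices X) = induced X A.
Proof.
move=> Xc; apply/setP => a; rewrite !inE subsetI.
have [aX|//] := boolP (a \in X); move: (aX).
by rewrite -{1}(induced_vertices Xc) inE => /andP[_ ->]; rewrite andbT.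
Qed.

Lemma link_complex X x : is_complex X -> x \in vertices X -> is_complex (link X x).
Proof.
case/complexP=> X0 Xsub; rewrite inE => Xx; apply/andP; split.
  by rewrite !inE X0 setU0 Xx.
apply/forall_inP => a; rewrite inE => /and3P[Xa nxa Xxa]; apply/forallP => b; apply/implyP => sba.
have nxb : x \notin b by apply: contra nxa; apply: subsetP.
by rewrite inE (Xsub a b) // nxb (Xsub _ (x |: b) Xxa) ?setUS.
Qed.

Lemma vertices_link X x : two_neighbourly X -> is_complex X -> x \in vertices X ->
  vertices (link X x) = vertices X :\ x.
Proof.
move=> X2 Xc Xx; apply/setP => v; rewrite !inE [x == v]eq_sym.
case: (v =P x); rewrite ?andbF //= => _; apply: andb_idr => Xv.
by apply: X2 => //; rewrite inE.
Qed.

Lemma vertices_induced X A : vertices (induced X A) = vertices X :&: A.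
Proof. by apply/setP => v; rewrite !inE sub1set. Qed.

End Subcomplexes.

(** * Coning off the link of a vertex *)

Section Step.
Variables (F : fieldType) (T : finType).
Implicit Types (X Y : {set {set T}}) (A B a b : {set T}).
Implicit Types (x v w : T) (s : nat) (c : chain F T).

Local Notation face := (face_chain F).
Local Notation bd := (boundary F T).
Local Notation abd := (aug_boundary F T).

(** Its kernel on chains of X[A + x] is the space of chains of X[A], so its
    image plays the role of the relative chains. *)
Definition star_part_fun x c : chain F T := [ffun a : {set T} => if x \in a then c a else 0].

Lemma star_part_is_linear x : linear (star_part_fun x).
Proof. by move=> k c c'; apply/ffunP => a; rewrite !ffunE; case: ifP; rewrite // scaler0 addr0. Qed.

HB.instance Definition _ x :=
  GRing.isLinear.Build F (chain F T) (chain F T) *:%R (star_part_fun x) (star_part_is_linear x).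

Definition star_part x : 'End(chain F T) := linfun (star_part_fun x).

(** The join with x, up to the sign that makes it anticommute with the
    boundary maps modulo faces avoiding x (star_boundary_cone). *)
Definition cone_fun x c : chain F T :=
  [ffun a : {set T} => if x \in a then (-1) ^+ position x a * c (a :\ x) else 0].

Lemma cone_is_linear x : linear (cone_fun x).
Proof.
move=> k c c'; apply/ffunP => a; rewrite !ffunE; case: ifP; rewrite ?scaler0 ?addr0 //.
by rewrite /GRing.scale /= mulrDr mulrCA.
Qed.

HB.instance Definition _ x :=
  GRing.isLinear.Build F (chain F T) (chain F T) *:%R (cone_fun x) (cone_is_linear x).

Definition cone x : 'End(chain F T) := linfun (cone_fun x).

Lemma star_part_face x a : star_part x (face a) = if x \in a then face a else 0.
Proof.
rewrite lfunE /=; apply/ffunP => b; rewrite ffunE (fun_if (fun c : chain F T => c b)) !ffunE.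
by case: (b =P a) => [->//|]; rewrite !if_same.
Qed.

Lemma cone_face x a : x \notin a -> cone x (face a) = (-1) ^+ position x a *: face (x |: a).
Proof.
move=> nxa; rewrite lfunE /=; apply/ffunP => b; rewrite !ffunE.
case: ifP => [xb | nxb]; last first.
  by case: eqP => [E|_]; [rewrite E setU11 in nxb | rewrite scaler0].
have ->: (b :\ x == a) = (b == x |: a).
  by apply/eqP/eqP=> [<-|->]; rewrite ?setD1K ?setU1K.
case: eqP => [->|_]; last by rewrite mulr0 scaler0.
by rewrite position_setU1 // ltnn addn0.
Qed.

(** The cone formula: the boundary of x * a is a - x * (boundary of a), and
    star_part discards the term a.  For a single vertex a this needs the
    augmented boundary on the right, as x * 0 = x for the empty face 0. *)
Lemma star_boundary_cone x a : x \notin a ->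
  star_part x (bd (cone x (face a))) = - cone x (abd (face a)).
Proof.
move=> nxa; rewrite cone_face // !linearZ /= boundary_face aug_boundary_face /face_boundary.
have [a0|a0] := eqVneq a set0.
  by rewrite a0 setU0 cards1 /aug_face_boundary big_set0 !linear0 ?scaler0 ?oppr0.
rewrite cardsU1 nxa add1n ltnS card_gt0 a0 big_setU1 //= linearD linear_sum /=.
rewrite linearZ /= star_part_face !inE eqxx /= scaler0 add0r.
rewrite /aug_face_boundary scaler_sumr [cone x _]linear_sum -sumrN; apply: eq_bigr => v av.
have nvx : v != x by apply: contra nxa => /eqP <-.
have nxv : x \notin a :\ v by rewrite inE negb_and nxa orbT.
rewrite !linearZ /= cone_face // star_part_face !inE eqxx eq_sym nvx /= -scaleNr !scalerA.
have -> : (x |: a) :\ v = x |: (a :\ v).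
  by rewrite setDUl; congr (_ :|: _); apply/setDidPl; rewrite disjoints1 inE eq_sym.
congr (_ *: _).
rewrite position_setU1 // (position_setD1 x v a) av /= mulrN -!exprD -[RHS]mulN1r.
rewrite -exprS -[LHS]signr_odd -[RHS]signr_odd; congr (_ ^+ _); congr nat_of_bool.
move: nvx; rewrite -(inj_eq enum_rank_inj) -val_eqE /=.
by case: ltngtP => // _ _; rewrite /= !oddD;
  case: (odd (position v a)); case: (odd (position x _)).
Qed.

Section ConeOverLink.
Variables (X : {set {set T}}) (A : {set T}) (x : T).
Hypotheses (Xc : is_complex X) (Xx : x \in vertices X) (nAx : x \notin A).

Local Notation Y := (induced X A).
Local Notation Z := (induced X (x |: A)).
Local Notation L := (induced (link X x) A).

Lemma link_face a : a \in L = (x \notin a) && (x |: a \in Z).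
Proof.
have [_ Xsub] := complexP Xc.
rewrite !inE; have [xa|xa] /= := boolP (x \in a).
  by rewrite andbF.
have -> : (x |: a \subset x |: A) = (a \subset A).
  by apply/idP/idP=> [/(setSD [set x])|]; [rewrite !setU1K | apply: setUS].
case XxA: (x |: a \in X); rewrite ?andbF //= andbT (Xsub _ _ XxA) //.
exact: subsetUr.
Qed.

Lemma old_face a : a \in Y = (a \in Z) && (x \notin a).
Proof.
rewrite !inE; case: (a \in X) => //=; apply/idP/andP=> [sa|[sa xa]].
  by rewrite (subset_trans sa) ?subsetUr //; split=> //; apply: contra nAx; apply: subsetP.
by rewrite -(setU1K nAx) subsetD1 sa.
Qed.

Lemma old_chains s : (sized_chains F Z s :&: lker (star_part x) = sized_chains F Y s)%VS.
Proof.
apply/vspaceP => c; rewrite memv_cap memv_ker lfunE /=.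
apply/andP/sized_chainsP=> [[/sized_chainsP Hc /eqP/ffunP c0] a ca | Hc].
  have [Za ->] := Hc _ ca; split=> //; rewrite old_face Za.
  by apply: contra ca => xa; have:= c0 a; rewrite !ffunE xa => ->.
split.
  by apply/sized_chainsP => a /Hc[]; rewrite old_face => /andP[].
apply/eqP/ffunP => a; rewrite !ffunE; case: ifP => // xa.
by apply/eqP/negPn/negP => /Hc[]; rewrite old_face xa andbF.
Qed.

Lemma star_chains s : (star_part x @: sized_chains F Z s.+1 = cone x @: sized_chains F L s)%VS.
Proof.
apply: subv_anti; apply/andP; split; apply: sized_chains_imgP => a aX sa.
  rewrite star_part_face; case: ifP => [xa|_]; last exact: mem0v.
  have Es := setD1K xa.
  have /memv_img-/(_ _ (cone x)): face (a :\ x) \in sized_chains F L s.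
    apply: face_sized_chains; first by rewrite link_face Es aX setD11.
    by apply: succn_inj; rewrite -sa (cardsD1 x a) xa.
  rewrite cone_face ?setD11 // Es => /(memvZ ((-1) ^+ position x (a :\ x))).
  by rewrite scalerA -expr2 sqrr_sign scale1r.
move: aX; rewrite link_face => /andP[nxa Zxa]; rewrite cone_face // memvZ //.
have -> : face (x |: a) = star_part x (face (x |: a)) by rewrite star_part_face setU11.
by rewrite memv_img ?face_sized_chains // cardsU1 nxa sa.
Qed.

Lemma dim_cone (U : {vspace chain F T}) s :
  (U <= sized_chains F L s)%VS -> \dim (cone x @: U) = \dim U.
Proof.
move=> /subvP sU; apply: limg_dim_eq; apply/eqP; rewrite -subv0; apply/subvP => c.
rewrite memv_cap memv_ker lfunE memv0 => /andP[/sU/sized_chainsP Hc /eqP/ffunP c0].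
apply/eqP/ffunP => a; rewrite [RHS]ffunE; apply/eqP/negPn/negP => /[dup] ca /Hc[].
rewrite link_face => /andP[nxa _] _; have := c0 (x |: a).
rewrite !ffunE setU11 setU1K // => /eqP; rewrite mulf_eq0 signr_eq0 /=.
exact/negP.
Qed.

(** The relative complex of the pair (X[A + x], X[A]) is the augmented chain
    complex of the link, shifted by one. *)
Lemma star_part_boundary s :
  (star_part x @: (bd @: sized_chains F Z s.+1) = cone x @: (abd @: sized_chains F L s))%VS.
Proof.
apply: subv_anti; apply/andP; split.
  rewrite -limg_comp; apply: sized_chains_imgP => a Za sa; rewrite comp_lfunE.
  have [xa|nxa] := boolP (x \in a); last first.
    have : bd (face a) \in (bd @: sized_chains F Y s.+1)%VS.
      by rewrite memv_img // face_sized_chains // old_face Za.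
    move/(subvP (boundary_sized _ s (induced_complex A Xc))).
    by rewrite -old_chains memv_cap memv_ker => /andP[_ /eqP->]; apply: mem0v.
  have nx : x \notin a :\ x by rewrite setD11.
  have -> : face a = (-1) ^+ position x (a :\ x) *: cone x (face (a :\ x)).
    by rewrite cone_face // setD1K // scalerA -expr2 sqrr_sign scale1r.
  rewrite 2!linearZ /= star_boundary_cone // memvZ // rpredN !memv_img //.
  apply: face_sized_chains; first by rewrite link_face setD1K // Za nx.
  by apply: succn_inj; rewrite -sa (cardsD1 x a) xa.
rewrite -limg_comp; apply: sized_chains_imgP => a; rewrite link_face => /andP[nxa Zxa] sa.
rewrite comp_lfunE -[cone x _]opprK -star_boundary_cone // rpredN !memv_img //.
by rewrite cone_face // memvZ // face_sized_chains // cardsU1 nxa sa.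
Qed.

End ConeOverLink.
End Step.

(** The rank that separates reduced from unreduced homology in degree 0. *)
Lemma dim_aug_boundary1 (F : fieldType) (T : finType) (X : {set {set T}}) :
  \dim (aug_boundary F T @: sized_chains F X 1) = (vertices X != set0).
Proof.
have abd1 v : aug_boundary F T (face_chain F [set v]) = face_chain F set0.
  rewrite aug_boundary_face /aug_face_boundary big_set1 setDv.
  by rewrite position_set1 ltnn scale1r.
have face0 : face_chain F (@set0 T) != 0.
  apply/eqP => /ffunP/(_ set0)/eqP; rewrite !ffunE eqxx; apply/negP; exact: oner_neq0.
case: set0Pn => [[v Xv]|X0] /=.
  rewrite inE in Xv; transitivity (\dim <[face_chain F (@set0 T)]>).
    2: by rewrite dim_vline face0.
  congr (\dim _); apply: subv_anti; apply/andP; split.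
    by apply: sized_chains_imgP => a _ /eqP/cards1P[w ->]; rewrite abd1 memv_line.
  by rewrite -memvE -(abd1 v) memv_img // face_sized_chains ?cards1.
apply/eqP; rewrite dimv_eq0 -subv0; apply: sized_chains_imgP => a Xa /eqP/cards1P[w Ea].
by case: X0; exists w; rewrite inE -Ea.
Qed.

(** * Betti numbers when one vertex is added *)

Section AddedVertex.
Variables (F : fieldType) (T : finType) (X : {set {set T}}) (A : {set T}) (x : T).
Hypotheses (Xc : is_complex X) (Xx : x \in vertices X) (nAx : x \notin A).

Local Notation Y := (induced X A).
Local Notation Z := (induced X (x |: A)).
Local Notation L := (induced (link X x) A).
Local Notation bd := (boundary F T).
Local Notation abd := (aug_boundary F T).

Definition new_boundaries s : {vspace chain F T} :=
  (sized_chains F Y s :&: (bd @: sized_chains F Z s.+1))%VS.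

(** The dimension of the kernel of H_(s-1)(Y) -> H_(s-1)(Z) when s > 0, by
    old_boundaries below. *)
Definition defect s : nat :=
  (\dim (new_boundaries s) - \dim (bd @: sized_chains F Y s.+1))%N.

Let sYZ : Y \subset Z := inducedS X (subsetUr [set x] A).

Lemma old_boundaries s : (bd @: sized_chains F Y s.+1 <= new_boundaries s)%VS.
Proof.
by rewrite subv_cap boundary_sized ?induced_complex // limgS // sized_chainsS.
Qed.

Lemma defect0 : defect 0 = 0%N.
Proof. by apply/eqP; rewrite subn_eq0 /new_boundaries !limg_boundary1 capv0. Qed.

Lemma defect_eq0 j : defect j.+1 = 0%N <-> injective (@homology_map F T Y Z j).
Proof.
rewrite homology_map_inj ?induced_complex // /defect -/(new_boundaries j.+1).
have [le eqE] := dimv_leqif_eq (old_boundaries j.+1).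
split=> [/eqP|sub].
  rewrite subn_eq0 => ge; have: \dim (bd @: sized_chains F Y j.+2) == \dim (new_boundaries j.+1).
    by rewrite eqn_leq le ge.
  by rewrite eqE => /eqP <-.
by apply/eqP; rewrite subn_eq0 dimvS.
Qed.

(** By rank-nullity for star_part, the faces of Z split between Y and L, and
    the rank of the boundary map of Z is that of Y, plus the defect, plus that
    of the augmented boundary map of L. *)
Lemma betti_step i :
  (betti F Y i + \dim (sized_chains F L i) =
   betti F Z i + defect i.+1 + defect i +
     \dim (abd @: sized_chains F L i.+1) + \dim (abd @: sized_chains F L i))%N.
Proof.
have Lc := induced_complex A (link_complex Xc Xx).
have bL s : (abd @: sized_chains F L s <= sized_chains F L s.-1)%VS.
  by case: s => [|s]; rewrite ?limg_aug_boundary0 ?sub0v ?aug_boundary_sized.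
have dimZ : \dim (sized_chains F Z i.+1) =
    (\dim (sized_chains F Y i.+1) + \dim (sized_chains F L i))%N.
  by rewrite -(limg_ker_dim (star_part F x)) old_chains // star_chains //
             (dim_cone Xc nAx (subvv _)).
have dimB s : \dim (bd @: sized_chains F Z s.+1) =
    (\dim (bd @: sized_chains F Y s.+1) + defect s + \dim (abd @: sized_chains F L s))%N.
  rewrite subnKC ?dimvS ?old_boundaries // -(limg_ker_dim (star_part F x)).
  rewrite star_part_boundary // (dim_cone Xc nAx (bL s)); congr (\dim _ + _)%N.
  rewrite /new_boundaries -(old_chains F X nAx) [LHS]capvC -[RHS]capvA [RHS]capvC -[RHS]capvA.
  by congr (_ :&: _)%VS; apply/esym/capv_idPl; rewrite boundary_sized ?induced_complex.
have := betti_rank F i (induced_complex A Xc).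
have := betti_rank F i (induced_complex (x |: A) Xc).
rewrite !dimB dimZ; lia.
Qed.

(** The contribution of (A, x) to mu_i, written with the unreduced
    conventions; for 2-neighbourly X it is the reduced Betti number, in degree
    i - 1 of the augmented chain complex, of the link cut down to A
    (local_muE). *)
Definition local_mu i : rat :=
  if i is k.+1 then (reduced_betti F L k)%:~R + ((k == 0%N) && (A == set0))%:R
  else (A == set0)%:R.

Lemma local_muE i : two_neighbourly X -> A \subset vertices X ->
  (\dim (sized_chains F L i))%:R - (\dim (abd @: sized_chains F L i.+1))%:R
    - (\dim (abd @: sized_chains F L i))%:R = local_mu i.
Proof.
move=> X2 sAX; have Lc := induced_complex A (link_complex Xc Xx).
have dim1 : \dim (abd @: sized_chains F L 1) = (A != set0).
  rewrite dim_aug_boundary1 vertices_induced vertices_link // setIC.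
  by have /setIidPl-> : A \subset vertices X :\ x by rewrite subsetD1 sAX nAx.
case: i => [|k] /=.
  rewrite dim1 limg_aug_boundary0 dimv0 subr0.
  have -> : \dim (sized_chains F L 0) = 1%N.
    rewrite [sized_chains F L 0](_ : _ = <[face_chain F set0]>%VS); last first.
      apply: subv_anti; apply/andP; split.
        apply/span_subvP => _ /imageP[a /andP[_ /eqP/cards0_eq->] ->].
        exact: memv_line.
      by rewrite -memvE face_sized_chains ?cards0 //; case/complexP: Lc.
    rewrite dim_vline; case: eqP => // /ffunP/(_ set0)/eqP.
    by rewrite !ffunE eqxx oner_eq0.
  by case: (A == set0); rewrite ?subr0 ?subrr.
have := betti_rank F k Lc; rewrite (limg_aug_boundary F L (s := k.+2)) //.
rewrite /reduced_betti; case: k => [|k] /=.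
  rewrite limg_boundary1 dimv0 addn0 dim1 => <-.
  by rewrite natrD rmorphB /=; case: (A == set0) => /=; ring.
by rewrite (limg_aug_boundary F L (s := k.+2)) // => <-; rewrite !natrD rmorphB /=; ring.
Qed.

End AddedVertex.

(** * The mu-vector as an average *)

Section Averages.
Variables (F : fieldType) (T : finType) (X : {set {set T}}).
Hypotheses (Xc : is_complex X) (X2 : two_neighbourly X).
Local Notation V := (vertices X).

Lemma sigma_link x k : x \in V ->
  sigma F (link X x) k =
  \sum_(A : {set T} | A \subset V :\ x)
     'C(#|V|.-1, #|A|)%:R^-1 * (reduced_betti F (induced (link X x) A) k)%:~R.
Proof.
move=> Vx; rewrite /sigma vertices_link // big_mkord.
have -> : #|V :\ x| = #|V|.-1 by rewrite (cardsD1 x V) Vx.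
under eq_bigr => j _ do rewrite mulr_sumr.
rewrite (exchange_big_dep (fun A : {set T} => A \subset V :\ x)) /=; last by move=> ? ? _ /andP[].
apply: eq_bigr => A sA.
have ltA : (#|A| < #|V|.-1.+1)%N.
  by rewrite ltnS; have := subset_leq_card sA; rewrite (cardsD1 x V) Vx.
rewrite (big_pred1 (Ordinal ltA)) // => j; rewrite sA /= -val_eqE /=; exact: eq_sym.
Qed.

(** The terms with A empty have total weight 1 (sum0 below): they are mu_0,
    and for i = 1 they are the Kronecker delta. *)
Lemma mu_weighted_sum i : V != set0 ->
  mu F X i = \sum_(x in V) \sum_(A : {set T} | A \subset V :\ x)
               weight V A * local_mu F X A x i.
Proof.
move=> V0.
have sum0 : \sum_(x in V) \sum_(A : {set T} | A \subset V :\ x)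
    weight V A * (A == set0)%:R = 1.
  rewrite -[RHS](weight0_sum V0); apply: eq_bigr => x _.
  rewrite (bigD1 set0) ?sub0set //= eqxx mulr1 big1 ?addr0 // => A /andP[_ /negPf->].
  exact: mulr0.
case: i => [|k] /=; first by rewrite sum0.
under [RHS]eq_bigr => x _ do under eq_bigr => A _ do rewrite mulrDr.
under [RHS]eq_bigr => x _ do rewrite big_split.
rewrite big_split addrC; congr (_ + _).
  rewrite mulr_sumr; apply: eq_bigr => x Vx; rewrite sigma_link // mulr_sumr.
  by apply: eq_bigr => A _; rewrite /weight invfM mulrA.
rewrite -[k.+1 == 1%N]/(k == 0%N); case: eqP => /= _; first by rewrite sum0.
by rewrite !big1 // => x _; rewrite big1 // => A _; rewrite mulr0.
Qed.

Lemma betti_set0 i : betti F (induced X set0) i = 0%N.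
Proof.
have := betti_rank F i (induced_complex set0 Xc).
suff -> : sized_chains F (induced X set0) i.+1 = 0%VS by rewrite dimv0; lia.
apply/eqP; rewrite -subv0; apply/span_subvP => _ /imageP[a /andP[+ +] ->].
by rewrite inE subset0 => /andP[_ /eqP->]; rewrite cards0.
Qed.

Lemma mu_sub_betti i : V != set0 ->
  mu F X i - (betti F X i)%:R =
  \sum_(x in V) \sum_(A : {set T} | A \subset V :\ x)
     weight V A * (defect F X A x i.+1 + defect F X A x i)%:R.
Proof.
move=> V0; rewrite mu_weighted_sum //.
have := weighted_sum_differences V (fun A => (betti F (induced X A) i)%:R).
rewrite betti_set0 subr0 induced_vertices // => <-.
rewrite -sumrB; apply: eq_bigr => x Vx; rewrite -sumrB; apply: eq_bigr => A.
rewrite subsetD1 => /andP[sA nAx]; rewrite -mulrBr; congr (_ * _).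
rewrite -local_muE // natrD.
have /(congr1 (fun n => n%:R : rat)) := betti_step F Xc Vx nAx i.
rewrite !natrD; set a := (\dim (sized_chains _ _ _))%:R; lra.
Qed.

End Averages.

(** * Tightness *)

Section Tightness.
Variables (F : fieldType) (T : finType) (X : {set {set T}}).
Hypothesis Xc : is_complex X.
Local Notation V := (vertices X).

(** If H_j(X[A]) -> H_j(X) is injective then so is its first factor
    H_j(X[A]) -> H_j(X[A + x]); conversely H_j(X[A]) -> H_j(X) is a composite
    of maps that add one vertex each, by induction on the number of missing
    vertices. *)
Lemma injective_all_iff_steps j :
  (forall A : {set T}, injective (@homology_map F T (induced X A) X j)) <->
  (forall x (A : {set T}), x \in V -> A \subset V :\ x -> defect F X A x j.+1 = 0%N).
Proof.
have sX B : induced X B \subset X by apply/subsetP => a; rewrite inE => /andP[].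
split=> [inj x A Vx _ | steps A].
  apply/defect_eq0 => //; apply/homology_map_inj; rewrite ?induced_complex ?inducedS ?subsetUr //.
  have /homology_map_inj := inj A; rewrite induced_complex // => /(_ Xc isT (sX A)).
  apply: subv_trans; rewrite capvS //.
  by rewrite limgS // sized_chainsS.
apply/homology_map_inj; rewrite ?induced_complex //.
rewrite -(induced_setI A Xc); set B := A :&: V.
have: B \subset V by apply: subsetIr.
move: {2}_.+1 (ltnSn #|V :\: B|) => n; elim: n => // n IHn in (B) * => leB sBV.
have [VB|[x]] := set_0Vmem (V :\: B).
  have -> : B = V by apply/eqP; rewrite eqEsubset sBV -setD_eq0 VB eqxx.
  by rewrite induced_vertices // capvSr.
rewrite inE => /andP[nBx Vx].
have sB : B \subset V :\ x by rewrite subsetD1 sBV.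
have /defect_eq0 inj := steps x B Vx sB.
have /homology_map_inj := inj Xc; rewrite !induced_complex ?inducedS ?subsetUr //.
move=> /(_ isT isT isT).
apply: subv_trans; rewrite subv_cap capvSl /=.
apply: subv_trans (IHn (x |: B) _ _).
- by rewrite capvS // sized_chainsS // inducedS // subsetUr.
- move: leB; rewrite ltnS; apply: leq_trans.
  by rewrite setUC -setDDl [X in (_ < X)%N](cardsD1 x) inE nBx Vx.
- by rewrite subUset sub1set Vx.
Qed.

(** Sum the boundaries of the edges of a path from u to v. *)
Lemma connected_boundaries u v : connected X -> u \in V -> v \in V ->
  face_chain F [set u] - face_chain F [set v] \in boundaries F X 0.
Proof.
move=> Xconn Vu Vv; have /connectP[p] := Xconn u v Vu Vv.
elim: p u {Vu} => [|y p IHp] u /=; first by move=> _ ->; rewrite subrr mem0v.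
case/andP=> Xuy py Ev; rewrite -(subrKA (face_chain F [set y])) rpredD ?IHp //.
have [->|nuy] := eqVneq u y; first by rewrite subrr mem0v.
have: boundary F T (face_chain F [set u; y]) \in boundaries F X 0.
  by rewrite memv_img // face_sized_chains // cards2 nuy.
rewrite boundary_face /face_boundary cards2 nuy /= big_setU1 ?inE //= big_set1.
have -> : [set u; y] :\ u = [set y] by rewrite setU1K // inE.
have -> : [set u; y] :\ y = [set u] by rewrite setUC setU1K // inE eq_sym.
rewrite !position_setU1 ?inE // !position_set1 !ltnn addn0 add0n.
have: enum_rank u != enum_rank y by rewrite (inj_eq enum_rank_inj).
rewrite -val_eqE /=; case: ltngtP => //= _ _; rewrite expr0 expr1 scale1r scaleN1r.
  by rewrite addrC.
by rewrite -rpredN opprB.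
Qed.

Lemma tight_two_neighbourly d : dimc X = d%:Z -> tight F X -> two_neighbourly X.
Proof.
move=> dimX [Xconn inj] u v Vu Vv.
have [->|nuv] := eqVneq u v; first by rewrite setUid; rewrite inE in Vv.
apply/negPn/negP => nX; pose Y := induced X [set u; v].
have sX : Y \subset X by apply/subsetP => a; rewrite inE => /andP[].
have Yc := induced_complex [set u; v] Xc.
have /(homology_map_inj F 0 Xc Yc sX) : injective (@homology_map F T Y X 0).
  by apply: inj; rewrite dimX.
have -> : sized_chains F Y 2 = 0%VS.
  apply/eqP; rewrite -subv0; apply/span_subvP => _ /imageP[a /andP[+ /eqP sa] ->].
  rewrite inE => /andP[Xa suv]; case/negP: nX; suff <-: a = [set u; v] by [].
  by apply/eqP; rewrite eqEcard suv sa cards2 nuv.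
rewrite limg0 => /subvP/(_ (face_chain F [set u] - face_chain F [set v])).
rewrite memv_cap connected_boundaries // andbT memv0 => H.
have: face_chain F [set u] - face_chain F [set v] == 0.
  rewrite !inE in Vu Vv.
  by apply: H; rewrite rpredB // face_sized_chains ?cards1 // inE ?Vu ?Vv sub1set !inE eqxx ?orbT.
move/eqP/ffunP/(_ [set u])/eqP; rewrite !ffunE eqxx (inj_eq set1_inj) (negPf nuv) subr0.
by rewrite oner_eq0.
Qed.

End Tightness.

Theorem theorem2p10 (F : fieldType) (T : finType) (X : {set {set T}}) (d : nat)
    (X_complex : is_complex X) (dimX : dimc X = d%:Z) :
  tight F X <->
    two_neighbourly X /\
    forall i : nat, (i <= d)%N -> mu F X i = (betti F X i)%:R :> rat.
Proof.
have V0 : vertices X != set0.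
  apply/eqP => V0; move: dimX; rewrite /dimc big1 // => a; rewrite -(induced_vertices X_complex).
  by rewrite inE V0 subset0 => /andP[_ /eqP->]; rewrite cards0.
split=> [tX | [X2 mu_betti]].
  have X2 := tight_two_neighbourly X_complex dimX tX.
  have defect_zero s x (A : {set T}) : (s <= d.+1)%N ->
      x \in vertices X -> A \subset vertices X :\ x ->
      defect F X A x s = 0%N.
    case: s => [|j] lejd Vx sA; first exact: defect0.
    apply: (proj1 (injective_all_iff_steps F X_complex j)) => // B.
    by case: tX => _; apply; rewrite dimX.
  split=> // i leid; apply/eqP; rewrite -subr_eq0 mu_sub_betti //.
  rewrite big1 // => x Vx; rewrite big1 // => A sA.
  by rewrite !defect_zero // ?mulr0 // ltnW.
split=> [u v Vu Vv | A j]; first by apply/connect1/X2.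
rewrite dimX => lejd; apply: (proj2 (injective_all_iff_steps F X_complex j)) => x B Vx sB.
have /eqP := mu_betti j lejd; rewrite -subr_eq0 mu_sub_betti // => /eqP.
have term_ge0 y (C : {set T}) : y \in vertices X -> C \subset vertices X :\ y ->
   0 <= weight (vertices X) C * (defect F X C y j.+1 + defect F X C y j)%:R.
  by move=> Vy sC; rewrite mulr_ge0 ?ler0n // ltW // (weight_gt0 sC).
move/psumr_eq0P => /(_ (fun y Vy => sumr_ge0 _ (fun C => term_ge0 y C Vy)) x Vx).
move/psumr_eq0P => /(_ (fun C => term_ge0 x C Vx) B sB) /eqP.
rewrite mulf_eq0 gt_eqF ?(weight_gt0 sB) //= pnatr_eq0 addn_eq0 => /andP[/eqP-> _].
by [].
Qed.
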